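(* Let $\alpha>1$, $m_0\in\mathcal P_\alpha(\mathbb R^d)$ and $R\ge R(\alpha,[m_0]_\alpha)$. For any Mean Field Games equilibrium $\eta\in\mathcal P_{m_0}(\Gamma_T,R)$ for $m_0$, the map $t\mapsto m^\eta_t:=e_t\sharp\eta$ is $\frac12$-Hölder continuous on $[0,T]$ with respect to $d_1$, i.e. there is a constant $\kappa\ge0$ such that $d_1(m^\eta_t,m^\eta_s)\le\kappa|t-s|^{1/2}$ for all $s,t\in[0,T]$.
   Context: Data: $T>0$; real matrices $A$ ($d\times d$) and $B$ ($d\times k$). $\mathcal P_p(\mathbb R^d)$ is the set of Borel probability measures on $\mathbb R^d$ with finite $p$-th moment and $d_1$ is the Kantorovich–Rubinstein (1-Wasserstein) distance. $L:\mathbb R^d\times\mathbb R^k\times\mathcal P_1(\mathbb R^d)\to\mathbb R$ and $G:\mathbb R^d\times\mathcal P_1(\mathbb R^d)\to\mathbb R$ satisfy the standing assumptions: (1) for each $m$, $(x,u)\mapsto L(x,u,m)$ is $C^2$, and $m\mapsto L(x,u,m)$ is $d_1$-Lipschitz with a constant independent of $(x,u)$; (2) $G$ is bounded and uniformly continuous on $\mathbb R^d\times\mathcal P_1(\mathbb R^d)$, and for each $m$, $x\mapsto G(x,m)$ is in $C^1_b(\mathbb R^d)$ (bounded with bounded uniformly continuous first derivatives); (3) there are constants $C_0>0$, $C_1,C_2\ge0$ such that for all $(x,u,m)$: $\frac{1}{C_0}\mathrm{Id}\le D^2_{uu}L(x,u,m)\le C_0\mathrm{Id}$, $\|D^2_{xu}L(x,u,m)\|\le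 C_1(1+|u|)$, and $|L(x,0,m)|+|D_xL(x,0,m)|+|D_uL(x,0,m)|\le C_2$. For $x\in\mathbb R^d$ and $u\in L^1(0,T;\mathbb R^k)$, $\gamma(\cdot;x,u)$ is the solution of $\dot\gamma=A\gamma+Bu$ on $[0,T]$, $\gamma(0)=x$. $\Gamma_T$ is the set of all such curves, with the uniform norm, $\Gamma_T(x)=\{\gamma\in\Gamma_T:\gamma(0)=x\}$, and $e_t(\gamma)=\gamma(t)$. Let $[m_0]_\alpha=\int|x|^\alpha\,m_0(dx)$. For $R\ge[m_0]_\alpha$, $$\mathcal P_{m_0}(\Gamma_T,R)=\Big\{\eta\in\mathcal P(\Gamma_T):\int_{\Gamma_T}\|\dot\gamma\|_{2}^\alpha\,\eta(d\gamma)\le R,\ e_0\sharp\eta=m_0\Big\},$$ where $\|\cdot\|_2$ is the $L^2(0,T)$ norm (equal to $+\infty$ if $\dot\gamma\notin L^2$). For $\eta$ in this set, let $J_\eta(x,u)=\int_0^TL(\gamma(t;x,u),u(t),e_t\sharp\eta)\,dt+G(\gamma(T;x,u),e_T\sharp\eta)$, and let $\Gamma^*_\eta(x)$ be the set of curves $\gamma(\cdot;x,u^* )$ where $u^*$ minimizes $J_\eta(x,\cdot)$ over $L^2(0,T;\mathbb R^k)$. A Mean Field Games equilibrium for $m_0$ is an $\eta\in\mathcal P_{m_0}(\Gamma_T,R)$ with $\operatorname{supp}(\eta)\subset\bigcup_{x\in\mathbb R^d}\Gamma^*_\eta(x)$. $R(\alpha,[m_0]_\alpha)\ge[m_0]_\alpha$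 denotes a positive constant such that, for every $R\ge R(\alpha,[m_0]_\alpha)$, the set $\mathcal P_{m_0}(\Gamma_T,R)$ is non-empty and for every $\eta$ in it there is $\nu\in\mathcal P_{m_0}(\Gamma_T,R)$ whose disintegration $\nu(d\gamma)=\int\nu_x(d\gamma)m_0(dx)$ with respect to $e_0$ satisfies $\operatorname{supp}(\nu_x)\subset\Gamma^*_\eta(x)$ for $m_0$-a.e. $x$ (such a constant exists). *)

(* Defs.v *)
From HB Require Import structures.
From mathcomp Require Import all_boot all_order all_algebra.
From mathcomp Require Import all_classical all_reals all_analysis.

Set Implicit Arguments.
Unset Strict Implicit.
Unset Printing Implicit Defensive.

Import Order.TTheory GRing.Theory Num.Theory.
Import numFieldNormedType.Exports.

Local Open Scope classical_set_scope.
Local Open Scope ring_scope.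

(* The library norm on matrices is the sup norm; |x| in the statement is the
   Euclidean norm. Both induce the same topology, hence the same Borel sets. *)
Definition enorm (R : realType) (n : nat) (x : 'cV[R]_n) : R :=
  Num.sqrt (\sum_i x i 0 ^+ 2).

Definition opnorm (R : realType) (m n : nat) (M : 'M[R]_(m, n)) : R :=
  sup [set enorm (M *m v) | v in [set v : 'cV[R]_n | enorm v <= 1]].

(* Loewner order *)
Definition loewner_le (R : realType) (n : nat) (M N : 'M[R]_n) : Prop :=
  forall v : 'cV[R]_n, (v^T *m M *m v) 0 0 <= (v^T *m N *m v) 0 0.

Section calculus.
Context {R : realType}.

(* In finite dimension, continuity of all the directional derivatives is the
   continuity of the differential. *)
Definition is_C1 (V : normedModType R) (f : V -> R) : Prop :=
  (forall x, differentiable f x) /\ (forall v, continuous ('D_v f)).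

Definition is_C2 (V : normedModType R) (f : V -> R) : Prop :=
  is_C1 f /\ (forall v, is_C1 ('D_v f)).

Definition basis_vec (n : nat) (i : 'I_n) : 'cV[R]_n := delta_mx i 0.

Definition grad (n : nat) (f : 'cV[R]_n -> R) (x : 'cV[R]_n) : 'cV[R]_n :=
  \col_i 'D_(basis_vec i) f x.

Definition hess (n : nat) (f : 'cV[R]_n -> R) (x : 'cV[R]_n) : 'M[R]_n :=
  \matrix_(i, j) 'D_(basis_vec j) ('D_(basis_vec i) f) x.

Definition cross_hess (n m : nat) (f : 'cV[R]_n -> 'cV[R]_m -> R)
    (x : 'cV[R]_n) (u : 'cV[R]_m) : 'M[R]_(n, m) :=
  \matrix_(i, j) 'D_(basis_vec i) (fun y => 'D_(basis_vec j) (f y) u) x.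

Definition is_C1b (n : nat) (f : 'cV[R]_n -> R) : Prop :=
  [/\ is_C1 f,
      exists M, forall x, `|f x| <= M,
      exists M, forall x, enorm (grad f x) <= M &
      forall e, 0 < e -> exists2 delta, 0 < delta &
        forall x y, enorm (x - y) < delta -> enorm (grad f x - grad f y) < e].

End calculus.

Notation borel X := (g_sigma_algebraType (@open X)).

Section borel_measures.
Context {R : realType}.

Definition msupp (X : ptopologicalType) (mu : set (borel X) -> \bar R) :
    set X :=
  [set x | forall U : set X, open U -> U x -> (0 < mu U)%E].

Context {n : nat}.
Notation V := ('cV[R]_n).

Definition moment (p : R) (m : probability (borel V) R) : \bar R :=
  (\int[m]_x (enorm x `^ p)%:E)%E.

Definition Pp (p : R) : set (probability (borel V) R) :=
  [set m | (moment p m < +oo)%E].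

(* A library measure is a function on all sets that is only constrained on the
   measurable ones, so equality of measures is tested on measurable sets. *)
Definition coupling (m m' : probability (borel V) R) :
    set (probability (borel V * borel V)%type R) :=
  [set pi | forall E : set (borel V), measurable E ->
     pi (fst @^-1` E) = m E /\ pi (snd @^-1` E) = m' E].

Definition d1 (m m' : probability (borel V) R) : \bar R :=
  ereal_inf [set (\int[pi]_z (enorm ((z.1 : V) - z.2))%:E)%E
            | pi in coupling m m'].

End borel_measures.

(* L and G are total in the measure argument, but constrained (and used) only
   on P_1. As d1 m m' = 0 when m and m' agree on Borel sets, the continuity
   assumptions in the measure argument make L and G independent of the values
   of a library measure on non-Borel sets. *)
Definition running_cost_assumption (R : realType) (d k : nat)
    (L : 'cV[R]_d -> 'cV[R]_k -> probability (borel 'cV[R]_d) R -> R) : Prop :=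
  [/\ forall m, Pp 1 m -> is_C2 (fun z : 'cV[R]_d * 'cV[R]_k => L z.1 z.2 m),
      exists2 K : R, 0 <= K & forall x u m m', Pp 1 m -> Pp 1 m' ->
        (`|L x u m - L x u m'|%:E <= K%:E * d1 m m')%E &
      exists C0 C1 C2 : R, [/\ 0 < C0, 0 <= C1, 0 <= C2 &
        forall x u m, Pp 1 m ->
          [/\ loewner_le (C0^-1)%:M (hess (fun v => L x v m) u),
              loewner_le (hess (fun v => L x v m) u) C0%:M,
              opnorm (cross_hess (fun y v => L y v m) x u)
                <= C1 * (1 + enorm u) &
              `|L x 0 m| + enorm (grad (fun y => L y 0 m) x)
                + enorm (grad (fun v => L x v m) 0) <= C2]]].

Definition terminal_cost_assumption (R : realType) (d : nat)
    (G : 'cV[R]_d -> probability (borel 'cV[R]_d) R -> R) : Prop :=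
  [/\ exists M, forall x m, Pp 1 m -> `|G x m| <= M,
      forall e : R, 0 < e -> exists2 delta : R, 0 < delta &
        forall x x' m m', Pp 1 m -> Pp 1 m' ->
          enorm (x - x') < delta -> (d1 m m' < delta%:E)%E ->
          `|G x m - G x' m'| < e &
      forall m, Pp 1 m -> is_C1b (fun x => G x m)].

Section control_system.
Context {R : realType} {d k : nat}.
Variables (T : R) (A : 'M[R]_d) (B : 'M[R]_(d, k)).

Local Notation leb := (@lebesgue_measure R).
Local Notation I := `[0 : R, T]%classic.

Definition L1_control (u : R -> 'cV[R]_k) : Prop :=
  forall j, leb.-integrable I (fun s => (u s j 0)%:E).

Definition L2_control (u : R -> 'cV[R]_k) : Prop :=
  (forall j, measurable_fun I (fun s => u s j 0)) /\
  (\int[leb]_(s in I) (enorm (u s) ^+ 2)%:E < +oo)%E.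

(* Caratheodory solutions, in integral form. A curve on [0, T] is encoded as a
   function on R vanishing outside [0, T]; it is thus determined by its
   restriction to [0, T]. *)
Definition is_solution (x : 'cV[R]_d) (u : R -> 'cV[R]_k)
    (g : R -> 'cV[R]_d) : Prop :=
  [/\ forall t, t \notin `[0, T] -> g t = 0,
      {within I, continuous g} &
      forall t, t \in `[0, T] -> forall i,
        g t i 0 = x i 0
          + \int[leb]_(s in `[0%R, t]%classic) (A *m g s + B *m u s) i 0].

(* There is exactly one solution when u is integrable; the default value of
   xget is never used then. *)
Definition trajectory (x : 'cV[R]_d) (u : R -> 'cV[R]_k) : R -> 'cV[R]_d :=
  xget (fun=> 0) [set g | is_solution x u g].

Definition curves : set {uniform` I -> 'cV[R]_d} :=
  [set g | exists x u, L1_control u /\ is_solution x u g].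

Definition GammaT : Type := set_type curves.

HB.instance Definition _ := Uniform.copy GammaT (set_type curves).

Lemma curves0 : ((fun=> 0) : {uniform` I -> 'cV[R]_d}) \in curves.
Proof.
rewrite inE; exists 0, (fun=> 0); split.
  move=> j; apply: (eq_integrable _ (cst 0%E)) => //.
    by move=> s _; rewrite mxE.
  exact: integrable0.
split=> // [|t _ i].
  by apply: continuous_subspaceT => x; exact: cst_continuous.
rewrite mxE add0r (_ : (fun _ => _) = cst 0) ?Rintegral_cst//= ?mul0r//.
by apply/funext => s; rewrite !mulmx0 addr0 mxE.
Qed.

HB.instance Definition _ := isPointed.Build GammaT
  (exist (fun g => g \in curves) _ curves0).

Definition evalT (t : R) (g : borel GammaT) : borel 'cV[R]_d := set_val g t.

Lemma evalT_continuous t : continuous (evalT t : GammaT -> 'cV[R]_d).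
Proof.
case: (boolP (t \in `[0, T])) => [tT g|tNT].
  apply: (@continuous_comp GammaT {uniform` I -> 'cV[R]_d} _ set_val
    (fun h : {uniform` I -> 'cV[R]_d} => h t)).
    exact: (@initial_continuous GammaT _ set_val).
  move=> W /nbhs_ballP[e e0 eW]; apply/uniform_nbhs.
  exists [set xy | ball xy.1 e xy.2]; split.
    exact: (entourage_ball _ (PosNum e0)).
  by move=> h gh; apply: eW; exact: (gh t tT).
rewrite (_ : evalT t = fun=> 0); first by move=> g; exact: cst_continuous.
apply/funext => -[g gC]; rewrite /evalT set_valE /=.
by have [x [u [_ [-> //]]]] := set_mem gC.
Qed.

Lemma evalT_measurable t : measurable_fun setT (evalT t).
Proof.
apply: (@measurability _ _ _ (borel 'cV[R]_d) _ _ (@open 'cV[R]_d)) => //.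
move=> _ [U oU <-]; rewrite setTI.
apply: sub_sigma_algebra.
by move/continuousP : (@evalT_continuous t); exact.
Qed.

HB.instance Definition _ t :=
  isMeasurableFun.Build _ _ _ _ (evalT t) (evalT_measurable t).

Definition marginal (eta : probability (borel GammaT) R) (t : R) :
    probability (borel 'cV[R]_d) R :=
  distribution eta (evalT t).

(* An extended real; the derivative exists for almost every time t in [0, T]
   and the value of derive1 g elsewhere is irrelevant. *)
Definition L2norm_deriv (g : borel GammaT) : \bar R :=
  ((\int[leb]_(t in I) (enorm (derive1 (set_val g : R -> 'cV[R]_d) t) ^+ 2)%:E) `^ 2^-1)%E.

Definition P_Gamma (alpha : R) (m0 : probability (borel 'cV[R]_d) R) (r : R) :
    set (probability (borel GammaT) R) :=
  [set eta : probability (borel GammaT) R |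
    (\int[eta]_g (L2norm_deriv g `^ alpha) <= r%:E)%E /\
    forall E : set (borel 'cV[R]_d), measurable E -> marginal eta 0 E = m0 E].

Section equilibrium.
Variables (L : 'cV[R]_d -> 'cV[R]_k -> probability (borel 'cV[R]_d) R -> R)
  (G : 'cV[R]_d -> probability (borel 'cV[R]_d) R -> R).

Definition cost (eta : probability (borel GammaT) R) (x : 'cV[R]_d)
    (u : R -> 'cV[R]_k) : \bar R :=
  (\int[leb]_(t in I) (L (trajectory x u t) (u t) (marginal eta t))%:E
    + (G (trajectory x u T) (marginal eta T))%:E)%E.

Definition Gamma_star (eta : probability (borel GammaT) R) (x : 'cV[R]_d) :
    set GammaT :=
  [set g | exists u, [/\ L2_control u,
     forall v, L2_control v -> (cost eta x u <= cost eta x v)%E &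
     set_val g = trajectory x u]].

Definition MFG_equilibrium (alpha : R) (m0 : probability (borel 'cV[R]_d) R)
    (r : R) (eta : probability (borel GammaT) R) : Prop :=
  P_Gamma alpha m0 r eta /\
  msupp (X := GammaT) eta `<=` \bigcup_x Gamma_star eta x.

Definition disintegration (m0 : probability (borel 'cV[R]_d) R)
    (nu : probability (borel GammaT) R)
    (nu_ : R.-pker (borel 'cV[R]_d) ~> (borel GammaT)) : Prop :=
  (forall E : set (borel GammaT), measurable E ->
     nu E = \int[m0]_x nu_ x E)%E /\
  {ae m0, forall x, nu_ x (evalT 0 @^-1` [set x]) = 1%E}.

Definition admissible_radius (alpha : R)
    (m0 : probability (borel 'cV[R]_d) R) (r0 : R) : Prop :=
  [/\ 0 < r0, (moment alpha m0 <= r0%:E)%E &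
    forall r, r0 <= r ->
      P_Gamma alpha m0 r !=set0 /\
      forall eta, P_Gamma alpha m0 r eta ->
        exists2 nu, P_Gamma alpha m0 r nu &
          exists2 nu_ : R.-pker (borel 'cV[R]_d) ~> (borel GammaT),
            disintegration m0 nu nu_ &
            {ae m0, forall x,
              msupp (X := GammaT) (nu_ x) `<=` Gamma_star eta x}].

End equilibrium.

End control_system.

(* Main.v *)
(* The image of eta under gamma |-> (gamma(t), gamma(s)) is a transport plan
   between the marginals at times t and s, so their distance is at most
   the eta-average of |gamma(t) - gamma(s)|. By Cauchy-Schwarz this increment is
   at most a dimensional constant times |t - s|^(1/2) ||gamma'||_2, and the
   average of ||gamma'||_2 is at most 1 + r because ||gamma'||_2 is bounded by
   1 + ||gamma'||_2^alpha, whose integral is controlled on P_{m0}(Gamma_T, r).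
   As gamma is given by an integral equation, gamma' = A gamma + B u almost
   everywhere by the Lebesgue differentiation theorem. *)
Require Import Defs.
From HB Require Import structures.
From mathcomp Require Import all_boot all_order all_algebra.
From mathcomp Require Import all_classical all_reals all_analysis.
From mathcomp Require Import measurable_realfun.
Import Order.TTheory GRing.Theory Num.Theory.
Import numFieldNormedType.Exports.
Local Open Scope classical_set_scope.
Local Open Scope ring_scope.

Set Implicit Arguments.
Unset Strict Implicit.

(** * Integral inequalities: comparison of lower integrals, Cauchy-Schwarz *)

Section integral_without_measurability.
Local Open Scope ereal_scope.
Context d (X : measurableType d) (R : realType).
Variable mu : {measure set X -> \bar R}.
Implicit Types (D E : set X) (f g : X -> \bar R).

(* The library integral of a nonnegative function is a lower integral, so
   monotonicity does not need measurability. *)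
Lemma ge0_le_lower_integral D f g : (forall x, D x -> 0 <= f x) ->
  (forall x, D x -> f x <= g x) ->
  \int[mu]_(x in D) f x <= \int[mu]_(x in D) g x.
Proof.
move=> f0 fg; have g0 x : D x -> 0 <= g x.
  by move=> Dx; exact: le_trans (f0 _ Dx) (fg _ Dx).
rewrite !ge0_integralE//; apply: ereal_sup_le => _ [h /= hf <-].
exists h => // x; apply: le_trans (hf x) _; exact: lee_restrict.
Qed.

(** Since [f] is measurable, its integral is unchanged when the null exceptional set [N] is removed
    from [D]; on what remains the comparison is pointwise. The upper function [g] can thus be one
    whose measurability has not been established, such as a squared derivative. *)
Lemma ge0_ae_le_lower_integral D E f g : measurable D -> measurable_fun D f ->
  D `<=` E -> (forall x, D x -> 0 <= f x) -> (forall x, E x -> 0 <= g x) ->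
  {ae mu, forall x, D x -> f x <= g x} ->
  \int[mu]_(x in D) f x <= \int[mu]_(x in E) g x.
Proof.
move=> mD mf DE f0 g0 [N [mN muN fgN]].
rewrite (ge0_negligible_integral mN mD mf f0 muN) [leLHS]integral_mkcond.
rewrite [leRHS]integral_mkcond; apply: ge0_le_lower_integral => x _.
  by apply: erestrict_ge0 => y [Dy _]; exact: f0.
rewrite !patchE; case: ifPn => [/set_mem[Dx Nx]|_].
  by rewrite mem_set//; [move/subsetCl : fgN; exact|exact: DE].
by case: ifPn => // /set_mem; exact: g0.
Qed.

End integral_without_measurability.

(** Hölder with exponents 2 and 2, applied to the indicator of [D] and to [f] extended by zero
    outside [D]. *)
Lemma cauchy_schwarz_integral d (X : measurableType d) (R : realType)
    (mu : {measure set X -> \bar R}) (D : set X) (f : X -> R) :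
  measurable D -> measurable_fun D f ->
  (\int[mu]_(x in D) `|f x|%:E <=
    mu D `^ 2^-1 * (\int[mu]_(x in D) (f x ^+ 2)%:E) `^ 2^-1)%E.
Proof.
move=> mD mf.
have mfD : measurable_fun setT (f \_ D) by exact/(measurable_restrictT _ _).1.
have half : 2^-1 + 2^-1 = 1 :> R by rewrite -[2^-1]div1r -splitr.
have := hoelder mu (measurable_indic mD) mfD (ltr0n _ 2) (ltr0n _ 2) half.
congr (_ <= _)%E.
- rewrite Lnorm1 [RHS]integral_mkcond; apply: eq_integral => x _ /=.
  rewrite indicE !patchE; case: ifPn => _; first by rewrite mul1r.
  by rewrite mul0r normr0.
- rewrite unlock; congr (_ * _)%E.
    congr (_ `^ _)%E.
    rewrite -[in RHS](setIT D) -integral_indic//.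
    apply: eq_integral => x _ /=.
    rewrite indicE; case: (x \in D); first by rewrite normr1 powR1.
    by rewrite normr0 powR0.
  congr (_ `^ _)%E.
  rewrite [RHS]integral_mkcond; apply: eq_integral => x _ /=.
  rewrite !patchE; case: ifPn => _; last by rewrite normr0 powR0.
  by rewrite powR_mulrn// real_normK// num_real.
Qed.

(** * Borel measurability of coordinates and of the Euclidean distance *)

Section borel_measurability.
Context (R : realType).

Lemma continuous_borel_measurable (V : ptopologicalType) (f : V -> R) :
  continuous f -> measurable_fun setT (f : borel V -> R).
Proof.
move=> cf; apply: (measurability _ (RGenOpens.measurableE R)).
move=> _ [_ [a [b ->] <-]]; rewrite setTI; apply: sub_sigma_algebra.
by move/continuousP : cf; apply; exact: interval_open.
Qed.

Lemma measurable_coord n (i : 'I_n) :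
  measurable_fun setT (fun x : borel 'cV[R]_n => (x : 'cV[R]_n) i 0).
Proof. by apply: continuous_borel_measurable; exact: coord_continuous. Qed.

(** The source carries the product of two Borel sigma-algebras, so measurability is obtained
    coordinate by coordinate rather than from continuity on the product space. *)
Lemma measurable_enormB n :
  measurable_fun setT (fun z : borel 'cV[R]_n * borel 'cV[R]_n =>
    enorm ((z.1 : 'cV[R]_n) - z.2)).
Proof.
apply: (measurableT_comp (continuous_measurable_fun (@sqrt_continuous R))).
apply: measurable_sum => i; apply: measurable_funX.
rewrite (_ : (fun _ => _) = (fun z : borel 'cV[R]_n * borel 'cV[R]_n =>
   (z.1 : 'cV[R]_n) i 0 - (z.2 : 'cV[R]_n) i 0)); last first.
  by apply/funext => z; rewrite !mxE.
apply: measurable_funB.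
  exact: measurableT_comp (measurable_coord i) measurable_fst.
exact: measurableT_comp (measurable_coord i) measurable_snd.
Qed.

End borel_measurability.

(** * Comparison of the Euclidean norm with coordinates *)

Lemma coord_le_enorm (R : realType) n (v : 'cV[R]_n) i : `|v i 0| <= enorm v.
Proof.
rewrite -sqrtr_sqr ler_wsqrtr// (bigD1 i)//= lerDl.
by apply: sumr_ge0 => j _; exact: sqr_ge0.
Qed.

Lemma enorm_le_sum (R : realType) n (v : 'cV[R]_n) :
  enorm v <= \sum_i `|v i 0|.
Proof.
have s0 : 0 <= \sum_i `|v i 0| by exact: sumr_ge0.
rewrite -[leRHS]ger0_norm// -sqrtr_sqr ler_wsqrtr// expr2 mulr_suml.
apply: ler_sum => i _; rewrite -real_normK ?num_real// expr2 ler_wpM2l//.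
by rewrite (bigD1 i)//= lerDl sumr_ge0.
Qed.

(** * Derivatives and increments of the controlled curves *)

Section curve_regularity.
Context (R : realType) (d k : nat) (T : R) (A : 'M[R]_d) (B : 'M[R]_(d, k)).
Notation leb := (@lebesgue_measure R).
Local Notation I := `[0 : R, T]%classic.

Lemma integrable_velocity x u g i : L1_control T u -> is_solution T A B x u g ->
  leb.-integrable I (fun s => ((A *m g s + B *m u s) i 0)%:E).
Proof.
move=> u1 [_ cg _].
have gj (j : 'I_d) : leb.-integrable I (fun s => (g s j 0)%:E).
  apply: (continuous_compact_integrable (f := fun s => g s j 0)).
    exact: segment_compact.
  move=> s.
  apply: (@continuous_comp (subspace I) _ _ g (fun v : 'cV[R]_d => v j 0)).
    exact: cg.
  exact: coord_continuous.
rewrite (_ : (fun _ => _) = (fun s =>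
    \sum_j (A i j)%:E * (g s j 0)%:E + \sum_j (B i j)%:E * (u s j 0)%:E)%E).
  by apply: integrableD => //; apply: integrable_sum => // j _;
    apply: integrableZl => //; exact: u1.
apply/funext => s; rewrite !mxE EFinD -!sumEFin.
by congr (_ + _)%E; apply: eq_bigr => j _; rewrite EFinM.
Qed.

(** The interval is open because the derivative is two-sided, while the encoded curve is zero
    outside [[0, T]] and may jump at the endpoints. *)
Lemma derive1_solution_ae x u g : L1_control T u -> is_solution T A B x u g ->
  {ae leb, forall t, t \in `]0, T[ -> derive1 g t = A *m g t + B *m u t}.
Proof.
move=> u1 gsol; have [_ _ gE] := gsol.
(* Extending the velocity by zero makes it integrable on the whole line, as the differentiation
   theorem is applied on every [[0, y]]. *)
pose f i := (fun s => (A *m g s + B *m u s) i 0) \_ I.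
have iF i : leb.-integrable setT (EFin \o f i).
  rewrite -restrict_EFin -integrable_mkcond//.
  exact: integrable_velocity i u1 gsol.
have locf i : locally_integrable setT (f i).
  by apply: integrable_locally => //; exact: integrable_velocity i u1 gsol.
have ftc (i : 'I_d) : {ae leb, forall t : R, 0 < t ->
    derivable (fun r : R => \int[leb]_(s in `[0, r]%classic) f i s) t 1 /\
    derive1 (fun r : R => \int[leb]_(s in `[0, r]%classic) f i s) t = f i t}.
  have itvf (y : R) : leb.-integrable `[0, y]%classic (EFin \o f i).
    exact: integrableS (iF i).
  have := @FTC1 R (f i) (BLeft 0) itvf (locf i).
  apply: filterS; first exact: (ae_filter_ringOfSetsType leb).
  by move=> t ft t0; apply: ft; rewrite lte_fin.
(* There are finitely many coordinates, so their exceptional sets merge into one null set. *)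
have : {ae leb, forall t i, t \in `]0, T[ ->
    derivable (fun s => g s i 0) t 1 /\ 'D_1 (fun s => g s i 0) t = f i t}.
  apply: (@filter_forall _ _ _ _ (ae_filter_ringOfSetsType leb)) => i.
  have := ftc i; apply: filterS; first exact: (ae_filter_ringOfSetsType leb).
  move=> t ft t0T.
  have t0 : 0 < t by rewrite (itvP t0T).
  have [dF eF] := ft t0.
  (* The integral equation holds in a whole neighbourhood of an interior [t], so both sides have the
     same derivative there. *)
  have Fg : {near t,
      (fun r : R => \int[leb]_(s in `[0, r]%classic) f i s + x i 0)
      =1 (fun r => g r i 0)}.
    near=> r.
    have r0T : r \in `]0, T[ by near: r; exact: near_in_itvoo.
    rewrite /= gE ?(subset_itv_oo_cc r0T)// addrC; congr (_ + _).
    apply: eq_Rintegral => s /set_mem/= s0r; rewrite /f patchE mem_set//=.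
    move: s0r r0T; rewrite !in_itv/= => /andP[-> sr] /andP[_ /ltW].
    exact: le_trans.
  split.
    apply: (near_eq_derivable Fg).
    by apply: derivableD => //; exact: derivable_cst.
  rewrite -(near_eq_derive _ Fg) -eF derive1E.
  have := deriveD dF (derivable_cst (x i 0) t 1).
  by rewrite derive_cst addr0.
apply: filterS; first exact: (ae_filter_ringOfSetsType leb).
move=> t gt t0T.
have dg : derivable g t 1.
  by apply/derivable_mxP => i j; rewrite ord1; exact: (gt i t0T).1.
rewrite derive1E derive_mx//; apply/matrixP => i j; rewrite !mxE ord1.
rewrite (gt i t0T).2 /f patchE mem_set ?mxE//.
exact: subset_itv_oo_cc.
Unshelve. all: by end_near. Qed.

Lemma coord_increment_le (g : borel (GammaT T A B)) s t (i : 'I_d) :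
  s \in `[0, T] -> t \in `[0, T] -> s <= t ->
  (`|(set_val g : R -> 'cV[R]_d) t i 0 - (set_val g : R -> 'cV[R]_d) s i 0|%:E
    <= (`|t - s| `^ 2^-1)%:E * L2norm_deriv g)%E.
Proof.
move=> s0T t0T st; have [x [u [u1 gsol]]] := set_mem (valP g).
rewrite set_valE /L2norm_deriv set_valE in gsol *.
set h : R -> 'cV[R]_d := (X in is_solution _ _ _ _ _ X) in gsol *.
have [_ _ hE] := gsol; have iv := integrable_velocity i u1 gsol.
set f := (fun r => (A *m h r + B *m u r) i 0) in iv.
have [s0 sT] : 0 <= s /\ s <= T by rewrite !(itvP s0T).
have [t0 tT] : 0 <= t /\ t <= T by rewrite !(itvP t0T).
(* Integrating over the open interval keeps every point inside []0, T[], where the formula for the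
   derivative is available. *)
have st0T : `]s, t[%classic `<=` `]0, T[%classic.
  by apply: subset_itv; rewrite bnd_simp.
have stI : `]s, t[%classic `<=` I by apply: subset_itv; rewrite bnd_simp.
have if_sub (J : interval R) : [set` J] `<=` I ->
    leb.-integrable [set` J] (EFin \o f).
  by move=> JI; apply: integrableS iv.
have -> : h t i 0 - h s i 0 = \int[leb]_(r in `]s, t[%classic) f r.
  rewrite !hE// opprD addrACA subrr add0r Rintegral_itvB ?bnd_simp//.
    rewrite Rintegral_itv_bndo_bndc//.
    exact: if_sub.
  by apply: if_sub; apply: subset_itv; rewrite bnd_simp.
have lst : leb `]s, t[%classic = `|t - s|%:E.
  rewrite lebesgue_measure_itv/= lte_fin ger0_norm ?subr_ge0//.
  case: ltP => // ts.
  by rewrite (@le_anti _ _ s t) ?subrr// st.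
have mf : measurable_fun `]s, t[%classic f.
  by have /integrableP[/measurable_EFinP] := if_sub _ stI.
apply: (@le_trans _ _ (\int[leb]_(r in `]s, t[%classic) `|f r|%:E)%E).
  rewrite EFin_normr_Rintegral//; last exact: if_sub.
  by apply: le_abse_integral => //; exact/measurable_EFinP.
apply: le_trans (cauchy_schwarz_integral leb (measurable_itv _) mf) _.
apply: lee_pmul; rewrite ?poweR_ge0//.
  by rewrite -poweR_EFin -lst.
apply: gt0_ler_poweR => //.
- by rewrite in_itv/= integral_ge0 ?leey// => r _; rewrite lee_fin sqr_ge0.
- by rewrite in_itv/= integral_ge0 ?leey// => r _; rewrite lee_fin sqr_ge0.
(* Almost everywhere [f] is a coordinate of the derivative, hence at most its norm; measurability is
   established for [f] alone. *)
apply: ge0_ae_le_lower_integral => //.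
- by apply/measurable_EFinP; exact: measurable_funX.
- by move=> r _; rewrite lee_fin sqr_ge0.
- by move=> r _; rewrite lee_fin sqr_ge0.
have := derive1_solution_ae u1 gsol.
apply: filterS; first exact: (ae_filter_ringOfSetsType leb).
move=> r hr /st0T/hr ->; rewrite lee_fin -real_normK ?num_real//.
by rewrite lerXn2r ?nnegrE ?coord_le_enorm// sqrtr_ge0.
Qed.

(** The factor [d] comes from bounding the Euclidean norm by the sum of the [d] coordinate
    increments, each with the same bound. *)
Lemma enorm_increment_le (g : borel (GammaT T A B)) s t :
  s \in `[0, T] -> t \in `[0, T] ->
  ((enorm ((evalT t g : 'cV[R]_d) - evalT s g))%:E
    <= (d%:R * `|t - s| `^ 2^-1)%:E * L2norm_deriv g)%E.
Proof.
move=> s0T t0T; rewrite EFinM -muleA.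
have -> : d%:R%:E = (\sum_(i < d) 1%:E)%E :> \bar R.
  by rewrite sumEFin sumr_const card_ord.
rewrite ge0_sume_distrl//; apply: (le_trans (y := (\sum_(i < d)
    `|((evalT t g : 'cV[R]_d) - evalT s g) i 0|%:E)%E)).
  by rewrite sumEFin lee_fin enorm_le_sum.
apply: lee_sum => i _; rewrite mul1e !mxE.
have [st|/ltW ts] := leP s t; first exact: coord_increment_le.
by rewrite distrC (distrC t s); exact: coord_increment_le.
Qed.

(** The plan is the joint law of the positions at times [t] and [s]; the second clause is the change
    of variables that turns its transport cost into an integral over curves. *)
Lemma marginal_coupling (eta : probability (borel (GammaT T A B)) R) s t :
  exists2 pi, coupling (marginal eta t) (marginal eta s) pi &
    forall f : borel 'cV[R]_d * borel 'cV[R]_d -> \bar R,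
      measurable_fun setT f -> (forall z, (0 <= f z)%E) ->
      (\int[pi]_z f z = \int[eta]_g f (evalT t g, evalT s g))%E.
Proof.
pose e (g : borel (GammaT T A B)) : borel 'cV[R]_d * borel 'cV[R]_d :=
  (evalT t g, evalT s g).
have me : measurable_fun setT e by apply: measurable_fun_pair.
pose X : {mfun borel (GammaT T A B) >->
    (borel 'cV[R]_d * borel 'cV[R]_d)%type} := mfun_Sub (mem_set me).
exists (distribution eta X) => // f mf f0.
by rewrite ge0_integral_distribution.
Qed.

End curve_regularity.

(** * From increments of curves to the distance between marginals *)

Lemma le_1DpowR (R : realType) (x a : R) : 0 <= x -> 1 <= a -> x <= 1 + x `^ a.
Proof.
move=> x0 a1; have [x1|/ltW x1] := leP x 1.
  by rewrite (le_trans x1)// lerDl powR_ge0.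
rewrite -[leLHS]powRr1// (le_trans (ler_powR x1 a1))//.
by rewrite lerDr.
Qed.

Unset Implicit Arguments.

Theorem theorem5p1 (R : realType) (d k : nat) (T : R) (hT : 0 < T)
  (A : 'M[R]_d) (B : 'M[R]_(d, k))
  (L : 'cV[R]_d -> 'cV[R]_k -> probability (borel 'cV[R]_d) R -> R)
  (G : 'cV[R]_d -> probability (borel 'cV[R]_d) R -> R)
  (hL : running_cost_assumption L) (hG : terminal_cost_assumption G)
  (alpha : R) (halpha : 1 < alpha)
  (m0 : probability (borel 'cV[R]_d) R) (hm0 : Pp alpha m0)
  (r0 : R) (hr0 : admissible_radius T A B L G alpha m0 r0)
  (r : R) (hr : r0 <= r)
  (eta : probability (borel (GammaT T A B)) R)
  (heta : MFG_equilibrium L G alpha m0 r eta) :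
  exists2 kappa : R, 0 <= kappa &
    forall s t : R, s \in `[0, T] -> t \in `[0, T] ->
      (d1 (marginal eta t) (marginal eta s)
        <= (kappa * `|t - s| `^ 2^-1)%:E)%E.
Proof.
have [[eta_r _] _] := heta.
have r_ge0 : 0 <= r.
  rewrite -lee_fin (le_trans _ eta_r)// integral_ge0// => g _.
  exact: poweR_ge0.
(* [d] comes from the increment bound, and [1 + r] bounds the integral of [1 + q g ^ alpha]
   below. *)
exists (d%:R * (1 + r)); first by rewrite mulr_ge0// addr_ge0.
move=> s t s0T t0T; have [pi pic piE] := marginal_coupling eta s t.
apply: (le_trans (ereal_inf_lbound (imageP _ pic))).
rewrite piE; last 2 first.
- by apply/measurable_EFinP; exact: measurable_enormB.
- by move=> z; rewrite lee_fin sqrtr_ge0.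
set c := d%:R * `|t - s| `^ 2^-1.
have c0 : 0 <= c by rewrite mulr_ge0// powR_ge0.
pose h (g : borel (GammaT T A B)) := enorm ((evalT t g : 'cV[R]_d) - evalT s g).
have hc g : ((h g)%:E <= c%:E * L2norm_deriv g)%E by exact: enorm_increment_le.
have h0 g : 0 <= h g by exact: sqrtr_ge0.
(* The integrals of nonmeasurable functions are lower integrals, which are not
   additive; hence the detour through the measurable quotient q, which is
   bounded by the norm of the derivative. When c = 0, both h and q vanish. *)
pose q g := h g / c.
have q0 g : 0 <= q g by rewrite divr_ge0.
have hE g : h g = c * q g.
  have [c00|cN0] := eqVneq c 0; last by rewrite /q mulrC divfK.
  apply/eqP; rewrite c00 mul0r eq_le h0 andbT -lee_fin.
  by rewrite (le_trans (hc g))// c00 mul0e.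
have qN g : ((q g)%:E <= L2norm_deriv g)%E.
  have [c00|cN0] := eqVneq c 0.
    by rewrite /q c00 invr0 mulr0 poweR_ge0.
  rewrite -(@lee_pmul2l _ c%:E)//; last by rewrite lte_fin lt_def cN0.
  by rewrite -EFinM -hE.
have mh : measurable_fun setT h.
  have mp : measurable_fun setT (fun g : borel (GammaT T A B) =>
    (evalT t g, evalT s g)) by exact: measurable_fun_pair.
  exact: measurableT_comp (@measurable_enormB R d) mp.
have mq : measurable_fun setT q by exact: measurable_funM.
have mqa : measurable_fun setT (fun g => (q g `^ alpha)%:E).
  apply/measurable_EFinP; exact: measurableT_comp (measurable_powR alpha) mq.
(* The moment bound passes to [q] by monotonicity of the lower integral. *)
have q_r : (\int[eta]_g (q g `^ alpha)%:E <= r%:E)%E.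
  apply: le_trans eta_r; apply: ge0_le_lower_integral => g _.
    by rewrite lee_fin powR_ge0.
  rewrite -poweR_EFin gt0_ler_poweR ?in_itv/= ?lee_fin ?leey//.
  - exact: ltW (lt_trans ltr01 halpha).
  - by rewrite q0.
  - by rewrite poweR_ge0.
(* This integrand is measurable, so from here on linearity of the integral applies. *)
apply: (@le_trans _ _ (\int[eta]_g (c%:E * (1 + (q g `^ alpha)%:E)))%E).
  apply: ge0_le_lower_integral => g _; first exact: (h0 g).
  rewrite -[X in X%:E]/(h g) hE -EFinD -EFinM lee_fin ler_wpM2l//.
  by rewrite le_1DpowR// ltW.
have -> : d%:R * (1 + r) * `|t - s| `^ 2^-1 = c * (1 + r) by rewrite mulrAC.
rewrite ge0_integralZl_EFin//; last 2 first.
- by move=> g _; rewrite -EFinD lee_fin addr_ge0// powR_ge0.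
- exact: emeasurable_funD.
rewrite [leRHS]EFinM lee_wpmul2l ?lee_fin//.
rewrite ge0_integralD//; last by move=> g _; rewrite lee_fin powR_ge0.
rewrite EFinD leeD// integral_cst// mul1e.
exact: probability_le1.
Qed.
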